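(* Let $G$ be a graph on $n$ vertices, let $\alpha\in[0,1]$, and let $\phi(B_\alpha)=\lambda^n+a_1\lambda^{n-1}+a_2\lambda^{n-2}+\cdots+a_{n-1}\lambda+a_n$ be the characteristic polynomial of $B_\alpha(G)$. Then for each $k\in\{1,\ldots,n\}$, $$a_k=\sum_{H}(-1)^{p(H)}\,2^{c(H)}\,(1-\alpha)^{c_2(H)}\,(2\alpha-1)^{k-c_2(H)}\left(\prod_{v_i\in\mathcal{C}_2(H)}d_G(v_i)\right),$$ where the summation is over all modified elementary subgraphs $H$ of $G$ with $k$ vertices.
   Context: All graphs are simple and undirected, with a finite vertex set. $A(G)$ is the adjacency matrix, $D(G)$ the diagonal matrix of vertex degrees, and $L(G)=D(G)-A(G)$ the Laplacian matrix of $G$. For $\alpha\in[0,1]$, $B_\alpha(G):=\alpha A(G)+(1-\alpha)L(G)$. The characteristic polynomial is $\det(\lambda I-B_\alpha(G))$. $d_G(v)$ is the degree of $v$ in $G$ (not in $H$). A subgraph $H$ of $G$ is a modified elementary subgraph if each component of $H$ is either a single vertex, a single edge (with its two ends), or a cycle. For such $H$: $c(H)$, $c_1(H)$, $c_2(H)$ are the numbers of components of $H$ that are cycles, edges, and vertices respectively; $p(H):=c(H)+c_1(H)+c_2(H)$ is the number of components; $\mathcal{C}_2(H)$ is the set of isolated vertices of $H$. Conventions: $0^0=1$ and empty products equal $1$. *)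

(* Defs.v *)
From HB Require Import structures.
From mathcomp Require Import all_boot all_order all_algebra.
Set Implicit Arguments.
Unset Strict Implicit.
Unset Printing Implicit Defensive.
Import Order.TTheory GRing.Theory Num.Theory.
Local Open Scope ring_scope.

Record sgraph (V : finType) := SGraph {
  adj :> rel V;
  adj_sym : symmetric adj;
  adj_irr : irreflexive adj }.

Definition degree (V : finType) (G : sgraph V) (v : V) : nat :=
  #|[set w | G v w]|.

(* An edge is represented by the set of its two ends. *)
Definition edges (V : finType) (G : sgraph V) : {set {set V}} :=
  [set f | [exists x, exists y, G x y && (f == [set x; y])]].

Definition adjacency (R : realFieldType) (n : nat) (G : sgraph 'I_n) : 'M[R]_n :=
  \matrix_(i, j) (G i j)%:R.

Definition degree_mx (R : realFieldType) (n : nat) (G : sgraph 'I_n) : 'M[R]_n :=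
  diag_mx (\row_j (degree G j)%:R).

Definition laplacian (R : realFieldType) (n : nat) (G : sgraph 'I_n) : 'M[R]_n :=
  degree_mx R G - adjacency R G.

Definition B_mx (R : realFieldType) (alpha : R) (n : nat) (G : sgraph 'I_n) : 'M[R]_n :=
  alpha *: adjacency R G + (1 - alpha) *: laplacian R G.

(* A candidate subgraph is a pair (vertex set, edge set); it need not be
   induced, spanning or connected. *)
Definition pregraph (V : finType) : finType :=
  ({set V} * {set {set V}})%type.

Definition is_subgraph (V : finType) (G : sgraph V) (H : pregraph V) : bool :=
  (H.2 \subset edges G) && [forall f in H.2, f \subset H.1].

Definition pre_adj (V : finType) (H : pregraph V) : rel V :=
  [rel x y | [set x; y] \in H.2].

Definition components (V : finType) (H : pregraph V) : {set pregraph V} :=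
  [set (C, [set f in H.2 | f \subset C])
     | C : {set V} in equivalence_partition (connect (pre_adj H)) H.1].

Definition is_vertex (V : finType) (K : pregraph V) : bool :=
  [exists x, K == ([set x], set0)].

Definition is_edge (V : finType) (K : pregraph V) : bool :=
  [exists x, exists y, (x != y) && (K == ([set x; y], [set [set x; y]]))].

(* [c] lists the vertices of the cycle in cyclic order; [next c x] is the
   successor of [x], the last vertex being followed by the first. *)
Definition is_cycle (V : finType) (K : pregraph V) : bool :=
  [exists c : #|K.1|.-tuple V,
    [&& (2 < size c)%N, uniq c, K.1 == [set x in c]
      & K.2 == [set [set x; next c x] | x in c]]].

Definition modified_elementary (V : finType) (G : sgraph V) (H : pregraph V) : bool :=
  is_subgraph G H &&
  [forall K in components H, [|| is_vertex K, is_edge K | is_cycle K]].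

Definition num_cycles (V : finType) (H : pregraph V) : nat :=
  #|[set K in components H | is_cycle K]|.

Definition num_edges (V : finType) (H : pregraph V) : nat :=
  #|[set K in components H | is_edge K]|.

Definition num_vertices (V : finType) (H : pregraph V) : nat :=
  #|[set K in components H | is_vertex K]|.

Definition num_components (V : finType) (H : pregraph V) : nat :=
  (num_cycles H + num_edges H + num_vertices H)%N.

Definition isolated (V : finType) (H : pregraph V) : {set V} :=
  [set v in H.1 | [forall f in H.2, v \notin f]].

(* Main.v *)
Require Import Defs.
From HB Require Import structures.
From mathcomp Require Import all_boot all_order all_algebra.
From mathcomp Require Import fingroup perm.
Set Implicit Arguments.
Unset Strict Implicit.
Unset Printing Implicit Defensive.
Import Order.TTheory GRing.Theory Num.Theory.
Local Open Scope ring_scope.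

(** Up to the sign (-1)^k, the coefficient of X^(n-k) in the characteristic
    polynomial of a matrix B is the sum of the principal k-minors, that is, the
    sum over the vertex sets S with k elements and the permutations s supported
    in S of the signed products of the entries B i (s i), i in S
    ([coef_char_poly_perm_on]).  Here B = (2 alpha - 1) A + (1 - alpha) D, so a
    fixed point i contributes (1 - alpha) d(i), while a moved point contributes
    2 alpha - 1 if {i, s i} is an edge of G and kills the product otherwise.

    The pairs (S, s) are grouped according to the graph that s draws on S, whose
    edges are the sets {x, s x} with s x != x ([perm_edges]).  Its components are
    the orbits of s in S: an orbit with one, two or more elements is a vertex, an
    edge or a cycle.  Hence s has a nonzero product only if its graph is a modified
    elementary subgraph of G ([modified_elementary_perm_graph]), and then that
    product depends on the graph alone ([perm_term]): the sign of s, multiplied by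
    (-1)^k, is -1 to the number of orbits of s in S, that is, of components.

    It remains to count the permutations drawing a given modified elementary
    subgraph H.  There is one, obtained by choosing a direction along each
    component ([modified_elementary_perm]).  Given one, s, every other sends each
    x to s x or to s^-1 x, with the same choice along a whole orbit; the choice
    matters exactly on the orbits with at least three elements, so there are
    2^c(H) such permutations ([card_same_edges]). *)

(** * Coefficients of the characteristic polynomial *)

(** In the Leibniz expansion of det (X I - A), each factor is either - A i (s i)
    or, when i is fixed by s, X.  Expanding the product over the set S of indices
    where the first summand is taken, the factors left outside S vanish unless s
    fixes every point there. *)
Lemma coef_char_poly_perm_on (R : comNzRingType) (n : nat) (A : 'M[R]_n) (k : nat) :
  (k <= n)%N ->
  (char_poly A)`_(n - k) =
  \sum_(S : {set 'I_n} | #|S| == k) \sum_(s : {perm 'I_n} | perm_on S s)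
    (-1) ^+ k * (-1) ^+ s * \prod_(i in S) A i (s i).
Proof.
move=> le_kn; rewrite /char_poly /determinant coef_sum.
rewrite (eq_bigr (fun s : 'S_n => \sum_(S : {set 'I_n} | (#|S| == k) && perm_on S s)
    (-1) ^+ k * (-1) ^+ s * \prod_(i in S) A i (s i))) => [|s _]; last first.
  have -> : \prod_i char_poly_mx A i (s i) =
      \prod_i (- (A i (s i))%:P + 'X *+ (i == s i)).
    by apply: eq_bigr => i _; rewrite !mxE addrC.
  rewrite bigA_distr big_distrr coef_sum big_mkcondr big_mkcond /=.
  rewrite [in RHS]big_mkcond; apply: eq_bigr => S _.
  have -> : \prod_i (if i \in S then - (A i (s i))%:P else 'X *+ (i == s i)) =
    ((-1) ^+ #|S| * \prod_(i in S) A i (s i))%:P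
      * (if perm_on S s then 'X^(n - #|S|) else 0) :> {poly R}.
    rewrite (bigID (mem S)) /=; congr (_ * _).
      rewrite -prodrN rmorph_prod.
      by apply: eq_bigr => i ->; rewrite rmorphN.
    case: ifPn => [onS | noS].
      rewrite (eq_bigr (fun=> 'X)) => [|i niS].
        rewrite prodr_const; congr (_ ^+ _).
        by have := cardC (mem S); rewrite card_ord => /(congr1 (subn^~ #|S|));
           rewrite addKn.
      by rewrite (negPf niS) (out_perm onS niS) eqxx.
    case/subsetPn: noS => i; rewrite inE => si niS.
    by rewrite (bigD1 i) //= (negPf niS) eq_sym (negPf si) mul0r.
  rewrite mulrA -[(-1) ^+ s]/(_ ^+ _) -(rmorph_sign polyC) -polyCM coefCM.
  case: (perm_on S s); rewrite ?coef0 ?mulr0 ?if_same //.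
  rewrite coefXn.
  have le_Sn : (#|S| <= n)%N by rewrite -[X in (_ <= X)%N](card_ord n) max_card.
  case: (eqVneq #|S| k) => [->|neq_Sk]; first by rewrite eqxx mulr1 mulrCA mulrA.
  case: eqP => [|_]; last by rewrite mulr0.
  by move=> /(congr1 (fun m => n - m)%N); rewrite !subKn // => /esym/eqP;
     rewrite (negPf neq_Sk).
rewrite (exchange_big_dep (fun S : {set 'I_n} => #|S| == k)) /= => [|s S _ /andP[] //].
by apply: eq_bigr => S /eqP Sk; apply: eq_bigl => s; rewrite Sk eqxx.
Qed.

(** * The graph drawn by a permutation *)

Lemma eq_set2 (V : finType) (a b c d : V) : ([set a; b] == [set c; d]) =
  ((a == c) && (b == d)) || ((a == d) && (b == c)).
Proof.
apply/eqP/idP => [E|/orP[]/andP[/eqP-> /eqP->] //]; last exact: setUC.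
have: [&& c \in [set a; b], d \in [set a; b], a \in [set c; d] & b \in [set c; d]].
  by rewrite E set21 set22 -E set21 set22.
rewrite !inE ![d == _]eq_sym ![c == _]eq_sym.
by case: (a == c); case: (a == d); case: (b == c); case: (b == d).
Qed.

Lemma card_sep_imset (aT rT : finType) (f : aT -> rT) (A : {set aT})
    (P : pred rT) :
  injective f -> #|[set y in f @: A | P y]| = #|[set x in A | P (f x)]|.
Proof.
move=> injf; rewrite -(card_imset _ injf); apply: eq_card => y; rewrite inE.
apply/andP/imsetP => [[/imsetP[x xA ->] Px]|[x]]; first by exists x; rewrite ?inE ?xA.
by rewrite inE => /andP[xA Px] ->; rewrite imset_f.
Qed.

Section PermGraph.

Variable V : finType.
Implicit Types (s t : {perm V}) (S C : {set V}) (x y z : V).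

Definition perm_edges s : {set {set V}} :=
  [set [set x; s x] | x : V & s x != x].

Lemma mem_perm_edges s x y :
  ([set x; y] \in perm_edges s) = (x != y) && ((y == s x) || (x == s y)).
Proof.
apply/imsetP/andP => [[z]|[nxy /orP[]/eqP E]].
- rewrite inE => sz /eqP; rewrite eq_set2.
  by case/orP=> /andP[/eqP-> /eqP->]; rewrite eqxx ?orbT // eq_sym.
- by exists x; rewrite ?inE -?E // eq_sym.
by exists y; rewrite ?inE -?E // setUC.
Qed.

Lemma perm_edgesP s f :
  reflect (exists2 x, s x != x & f = [set x; s x]) (f \in perm_edges s).
Proof.
by apply: (iffP imsetP) => -[x]; rewrite ?inE => sx ->; exists x; rewrite ?inE.
Qed.

Lemma porbit_apply s x : porbit s (s x) = porbit s x.
Proof. exact: (porbit_perm s 1). Qed.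

Lemma porbit_applyV s x : porbit s (s^-1%g x) = porbit s x.
Proof. by rewrite -(porbit_apply s (s^-1%g x)) permKV. Qed.

Lemma porbit_ind s (P : pred V) x :
  (forall y, P y -> P (s y)) -> P x -> {in porbit s x, forall y, P y}.
Proof.
move=> Ps Px y /porbitP[i ->]; elim: i => [|i IHi]; first by rewrite expg0 perm1.
by rewrite expgSr permM; apply: Ps.
Qed.

Lemma porbit_fixed s x : s x = x -> porbit s x = [set x].
Proof.
move=> sx; apply/setP=> y; rewrite inE; apply/idP/eqP => [|->]; last exact: porbit_id.
by move/(porbit_ind (P := pred1 x)) => H; apply/eqP/H => //= z /eqP->; rewrite sx.
Qed.

Lemma card_porbit_gt2 s x : (2 < #|porbit s x|)%N = (s (s x) != x).
Proof.
have sub0 : [set x; s x] \subset porbit s x.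
  by rewrite subUset !sub1set porbit_id -(porbit_apply s x) porbit_id.
case: eqP => [ssx|/eqP ssx] /=.
  apply/negbTE; rewrite -leqNgt.
  have /subset_leq_card : porbit s x \subset [set x; s x].
    apply/subsetP; apply: (porbit_ind (P := fun y => y \in [set x; s x])) => [y|];
      by rewrite !inE ?eqxx // => /orP[]/eqP->; rewrite ?ssx eqxx ?orbT.
  by move/leq_trans; apply; rewrite cards2; case: (_ != _).
have sxx : s x != x by apply: contraNneq ssx => E; rewrite !E.
have sub : [set x; s x; s (s x)] \subset porbit s x.
  rewrite subUset sub0 sub1set -(porbit_apply s x) -(porbit_apply s (s x)).
  by rewrite porbit_id.
apply: leq_trans (subset_leq_card sub).
by rewrite setUC cardsU1 cards2 !inE negb_or ssx (inj_eq perm_inj) sxx eq_sym sxx.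
Qed.

(** * Permutations drawing the same graph *)

Section Reversal.

Variables (s : {perm V}) (J : {set {set V}}).

Let rev_fun x := if porbit s x \in J then s^-1%g x else s x.

Fact rev_fun_inj : injective rev_fun.
Proof.
apply: (can_inj (g := fun x => if porbit s x \in J then s x else s^-1%g x)) => x.
rewrite /rev_fun; case xJ: (porbit s x \in J).
  by rewrite porbit_applyV xJ permKV.
by rewrite porbit_apply xJ permK.
Qed.

(** Reversing orbits is the only freedom left by the graph of a permutation. *)
Definition reverse_orbits : {perm V} := perm rev_fun_inj.

Lemma reverse_orbitsE x :
  reverse_orbits x = if porbit s x \in J then s^-1%g x else s x.
Proof. by rewrite permE. Qed.

Lemma perm_edges_reverse : perm_edges reverse_orbits = perm_edges s.
Proof.
apply/setP=> f; apply/perm_edgesP/perm_edgesP => -[x]; last first.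
  move=> sx ->; case: (boolP (porbit s x \in J)) => xJ.
    by exists (s x); rewrite reverse_orbitsE porbit_apply xJ permK // 1?setUC // eq_sym.
  by exists x; rewrite reverse_orbitsE (negPf xJ).
rewrite reverse_orbitsE; case: ifP => _ sx ->; last by exists x.
by exists (s^-1%g x); rewrite permKV // 1?setUC // eq_sym.
Qed.

End Reversal.

Definition long_orbits s := [set C in porbits s | 2 < #|C|]%N.

(** The neighbours of x in the graph of s are s x and s^-1 x, and t x is one of
    them unless x is fixed by t; a point is fixed when it lies on no edge, which
    the graph tells. *)
Lemma same_edges_apply s t x : perm_edges s = perm_edges t ->
  t x = s x \/ t x = s^-1%g x.
Proof.
move=> E; case: (eqVneq (t x) x) => [tx | tx].
  left; apply/eqP; rewrite tx; apply: contraT => sx.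
  have: [set x; s x] \in perm_edges t by rewrite -E mem_perm_edges eqxx sx.
  rewrite mem_perm_edges => /andP[_ /orP[]]; rewrite ?tx eq_sym ?(negPf sx) //.
  by rewrite -{2}tx (inj_eq perm_inj) eq_sym (negPf sx).
have: [set x; t x] \in perm_edges s by rewrite E mem_perm_edges eqxx eq_sym tx.
rewrite mem_perm_edges => /andP[_ /orP[/eqP|/eqP xE]]; first by left.
by right; rewrite {2}xE permK.
Qed.

(** If t sends x to y = s x, it can only continue from y to s y or go back to x.
    In the latter case t swaps x and y, so the edge between x and y is the only one
    at y and s has to go back as well. *)
Lemma same_edges_invariant s t x : perm_edges s = perm_edges t ->
  t x = s x -> t (s x) = s (s x).
Proof.
move=> E tx; case: (same_edges_apply (s x) E) => [//|]; rewrite permK => tsx.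
case: (same_edges_apply (s x) (esym E)) => [->//|].
by rewrite tsx -{2}tx permK.
Qed.

(** The permutations with the graph of s are the reversals of s along sets of
    orbits.  Reversing an orbit with at most two points changes nothing, while on a
    longer one s and s^-1 differ everywhere, so these reversals correspond to the
    sets of long orbits. *)
Lemma card_same_edges s :
  #|[set t | perm_edges t == perm_edges s]| = (2 ^ #|long_orbits s|)%N.
Proof.
rewrite -card_powerset -(card_in_imset (f := reverse_orbits s)); last first.
  (* An orbit on which s and s^-1 agree at some point has at most two elements. *)
  have sub (J1 J2 : {set {set V}}) : J1 \subset long_orbits s ->
      reverse_orbits s J1 = reverse_orbits s J2 -> J1 \subset J2.
    move=> sJ1 E; apply/subsetP=> C CJ1; apply: contraT => CJ2.
    have := subsetP sJ1 _ CJ1; rewrite inE => /andP[/imsetP[x _ Cx]].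
    rewrite Cx card_porbit_gt2 => /negP[]; have := congr1 (@fun_of_perm V ^~ x) E.
    by rewrite /= !reverse_orbitsE -Cx CJ1 (negPf CJ2) => <-; rewrite permKV.
  move=> J1 J2; rewrite !inE => s1 s2 E.
  by apply/eqP; rewrite eqEsubset (sub J1 J2) ?(sub J2 J1).
apply: eq_card => t; rewrite inE; apply/eqP/imsetP => [E|[J _ ->]]; last first.
  exact: perm_edges_reverse.
(* Orbits on which t runs against s. *)
exists [set C in long_orbits s | [forall x in C, t x == s^-1%g x]].
  by rewrite inE; apply/subsetP=> C; rewrite inE => /andP[].
apply/permP=> x; rewrite reverse_orbitsE; case: ifPn => [|].
  by rewrite inE => /andP[_ /forall_inP/(_ x (porbit_id s x))/eqP].
rewrite inE negb_and => /orP[|].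
  rewrite inE negb_and imset_f //= card_porbit_gt2 negbK => /eqP ssx.
  have sV : s^-1%g x = s x by rewrite -{1}ssx permK.
  by case: (same_edges_apply x (esym E)) => ->.
rewrite negb_forall => /existsP[y]; rewrite negb_imply porbit_sym => /andP[xy ty].
have ty' : t y = s y.
  by case: (same_edges_apply y (esym E)) => // E'; rewrite E' eqxx in ty.
apply/eqP; move: x xy; apply: (porbit_ind (P := fun x => t x == s x)); last exact/eqP.
by move=> z /eqP tz; apply/eqP/same_edges_invariant.
Qed.

End PermGraph.

(** * Components of the graph of a permutation *)

Section PermGraphComponents.

Variable V : finType.
Implicit Types (s t : {perm V}) (S C : {set V}) (x y z : V) (G : sgraph V).
Implicit Types (K H : pregraph V).

Lemma perm_on_same_edges S s t :
  perm_edges s = perm_edges t -> perm_on S s -> perm_on S t.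
Proof.
move=> E /subsetP onS; apply/subsetP=> x; rewrite inE => tx; apply: onS.
rewrite inE; apply: contraNneq tx => sx.
by case: (same_edges_apply x E) => ->; rewrite ?sx // -{1}sx permK.
Qed.

Lemma connect_perm_graph S s x y :
  connect (pre_adj (S, perm_edges s)) x y = (y \in porbit s x).
Proof.
apply/idP/idP => [|/porbitP[i ->]]; last first.
  elim: i => [|i IHi]; first by rewrite expg0 perm1.
  rewrite expgSr permM; apply: connect_trans IHi _; set z := (s ^+ i)%g x.
  case: (eqVneq (s z) z) => [->//|sz].
  by apply: connect1; rewrite /pre_adj /= mem_perm_edges eqxx eq_sym sz.
case/connectP=> p + ->; elim: p x => [|z p IHp] x /=; first by rewrite porbit_id.
rewrite {1}/pre_adj /= mem_perm_edges => /andP[/andP[_ xz] /IHp].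
suff -> : porbit s z = porbit s x by [].
by case/orP: xz => /eqP->; rewrite porbit_apply.
Qed.

Definition orbits_in S s := [set porbit s x | x in S].

Definition induced s C : pregraph V := (C, [set f in perm_edges s | f \subset C]).

Lemma perm_on_porbit S s x : perm_on S s -> x \in S -> porbit s x \subset S.
Proof.
move=> onS xS; apply/subsetP; apply: porbit_ind => // y.
by rewrite perm_closed.
Qed.

Lemma components_perm_graph S s : perm_on S s ->
  components (S, perm_edges s) = induced s @: orbits_in S s.
Proof.
move=> onS; rewrite /components /=.
suff -> : equivalence_partition (connect (pre_adj (S, perm_edges s))) S =
          orbits_in S s by [].
apply: eq_in_imset => x xS; apply/setP=> y; rewrite inE connect_perm_graph.
by apply: andb_idl; apply: (subsetP (perm_on_porbit onS xS)).
Qed.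

Lemma induced_inj s : injective (induced s).
Proof. by move=> C1 C2 []. Qed.

Lemma card_is_vertex K : is_vertex K -> #|K.1| = 1%N.
Proof. by case/existsP=> x /eqP->; rewrite cards1. Qed.

Lemma card_is_edge K : is_edge K -> #|K.1| = 2%N.
Proof. by case/existsP=> x /existsP[y /andP[xy /eqP->]]; rewrite cards2 xy. Qed.

Lemma card_is_cycle K : is_cycle K -> (2 < #|K.1|)%N.
Proof. by case/existsP=> c /and4P[]; rewrite size_tuple. Qed.

Lemma card_perm_edge s f : f \in perm_edges s -> #|f| = 2%N.
Proof. by case/perm_edgesP=> x sx ->; rewrite cards2 eq_sym sx. Qed.

Lemma induced_porbit_edges s x :
  (induced s (porbit s x)).2 = [set [set y; s y] | y in porbit s x & s y != y].
Proof.
apply/setP=> f; rewrite inE; apply/andP/imsetP => [[/perm_edgesP[y sy ->]]|[y]].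
  by rewrite subUset sub1set => /andP[yx _]; exists y; rewrite ?inE ?yx.
rewrite inE => /andP[yx sy] ->; split; first by apply/perm_edgesP; exists y.
have yE : porbit s y = porbit s x by apply/eqP; rewrite eq_porbit_mem.
by rewrite subUset !sub1set yx -yE -(porbit_apply s y) porbit_id.
Qed.

(** The list x, s x, s (s x), ... of the points of the orbit is a cyclic order
    along its edges as soon as the orbit has more than two points. *)
Lemma induced_porbit_elementary s x (K := induced s (porbit s x)) :
  [|| is_vertex K, is_edge K | is_cycle K].
Proof.
case: (ltngtP #|porbit s x| 2) => [lt2|gt2|/eqP eq2].
- have /eqP/cards1P[z xz] : #|porbit s x| = 1%N.
    by case: #|_| lt2 (card_porbit_neq0 s x) => [|[]].
  apply/or3P/Or31/existsP; exists z; rewrite /K /induced xz.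
  apply/eqP; congr (_, _); apply/setP=> f; rewrite !inE.
  apply/negbTE/negP=> /andP[/card_perm_edge f2 /subset_leq_card].
  by rewrite f2 cards1.
- apply/or3P/Or33.
  have sz_c : size (traject s x #|porbit s x|) == #|K.1| by rewrite size_traject.
  apply/existsP; exists (Tuple sz_c); apply/and4P; split=> //=.
  + by rewrite size_traject.
  + exact: uniq_traject_porbit.
  + by apply/eqP/setP=> y; rewrite inE porbit_traject.
  have cyc : path.cycle (frel s) (traject s x #|porbit s x|).
    have := iter_porbit s x; case: #|_| => [//|m] E.
    suff -> : path.cycle (frel s) (traject s x m.+1) =
              fpath s x (traject s (s x) m.+1) by apply: fpath_traject.
    by rewrite [traject s (s x) _]trajectSr -iterSr E.
  rewrite -[X in X == _]/((induced s (porbit s x)).2) induced_porbit_edges; apply/eqP.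
  have -> : [set y in porbit s x | s y != y] = [set y in porbit s x].
    apply/setP=> y; rewrite !inE; apply: andb_idr => yx.
    have yE : porbit s y = porbit s x by apply/eqP; rewrite eq_porbit_mem.
    by apply: contraTneq gt2 => /porbit_fixed; rewrite -yE => ->; rewrite cards1.
  apply/setP=> f; apply/imsetP/imsetP => -[y].
    rewrite inE porbit_traject => yx ->; exists y => //=.
    by rewrite -(eqP (next_cycle cyc yx)).
  move=> yx ->; exists y; first by rewrite inE porbit_traject.
  by rewrite -(eqP (next_cycle cyc yx)).
apply/or3P/Or32.
have /cards2P[y [z [yz xyz]]] := eq2.
apply/existsP; exists y; apply/existsP; exists z; rewrite yz -xyz /=.
apply/eqP; congr (_, _); apply/setP=> f; rewrite !inE.
apply/andP/eqP => [[/card_perm_edge f2 fx]|->].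
  by apply/eqP; rewrite eqEcard fx f2 (eqP eq2).
split=> //; apply/perm_edgesP; exists x.
  by apply: contraTneq eq2 => /porbit_fixed->; rewrite cards1.
have sx : s x != x by apply: contraTneq eq2 => /porbit_fixed->; rewrite cards1.
apply/esym/eqP; rewrite eqEcard subUset !sub1set porbit_id.
by rewrite -{1}(porbit_apply s x) porbit_id cards2 eq_sym sx (eqP eq2).
Qed.

(** A vertex, an edge and a cycle have respectively one, two and at least three
    vertices, so the size of an orbit decides which of the three it is. *)
Lemma induced_porbit_type s x (K := induced s (porbit s x)) :
  [/\ is_vertex K = (#|porbit s x| == 1%N), is_edge K = (#|porbit s x| == 2%N)
    & is_cycle K = (2 < #|porbit s x|)%N].
Proof.
rewrite -[#|porbit s x|]/#|K.1|.
have elemK : [|| is_vertex K, is_edge K | is_cycle K].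
  exact: induced_porbit_elementary.
split; apply/idP/idP; try by [
  move/card_is_vertex-> | move/card_is_edge-> | move/card_is_cycle].
- by case/or3P: elemK => // [/card_is_edge->|/card_is_cycle]; case: #|K.1| => [|[]].
- by case/or3P: elemK => // [/card_is_vertex->|/card_is_cycle]; case: #|K.1| => [|[|[]]].
by case/or3P: elemK => // [/card_is_vertex->|/card_is_edge->].
Qed.

(** The components of the graph of s have the required shape for every s, so
    that only the inclusion of its edges in those of G is at stake. *)
Lemma modified_elementary_perm_graph G S s : perm_on S s ->
  modified_elementary G (S, perm_edges s) = [forall x, (s x != x) ==> G x (s x)].
Proof.
move=> onS; apply/andP/forall_inP => [[/andP[/subsetP sub _] _] x sx|Gs].
  have /sub : [set x; s x] \in perm_edges s by apply/perm_edgesP; exists x.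
  rewrite inE => /existsP[y /existsP[z /andP[Gyz]]]; rewrite eq_set2.
  by case/orP=> /andP[/eqP-> /eqP->]; rewrite // adj_sym.
split; last first.
  rewrite components_perm_graph //; apply/forall_inP=> K /imsetP[C /imsetP[x _ ->] ->].
  exact: induced_porbit_elementary.
apply/andP; split.
  apply/subsetP=> f /perm_edgesP[x sx ->]; rewrite inE.
  by apply/existsP; exists x; apply/existsP; exists (s x); rewrite Gs ?eqxx.
apply/forall_inP=> f /perm_edgesP[x sx ->] /=.
have xS : x \in S by apply: contraR sx => /(out_perm onS)->.
by rewrite subUset !sub1set perm_closed // xS.
Qed.

Lemma isolated_perm_graph S s : perm_on S s ->
  isolated (S, perm_edges s) = [set x in S | s x == x].
Proof.
move=> onS; apply/setP=> x; rewrite !inE /=; congr (_ && _).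
apply/forall_inP/eqP => [noE|sx f /perm_edgesP[y sy ->]].
  apply/eqP; apply: contraT => sx.
  by have := noE [set x; s x]; rewrite mem_perm_edges eqxx eq_sym sx set21 => /(_ isT).
rewrite !inE; apply: contra sy => /orP[]/eqP E; first by rewrite -E sx.
by rewrite -(inj_eq (@perm_inj _ s)) -E sx.
Qed.

Lemma num_vertices_perm_graph S s : perm_on S s ->
  num_vertices (S, perm_edges s) = #|isolated (S, perm_edges s)|.
Proof.
move=> onS; rewrite isolated_perm_graph // /num_vertices components_perm_graph //.
rewrite card_sep_imset; last exact: induced_inj.
rewrite -(card_imset _ (@set1_inj V)); apply: eq_card => C; rewrite inE.
apply/andP/imsetP => [[/imsetP[x xS ->]]|[x]].
  case: (induced_porbit_type s x) => -> _ _ /cards1P[z xz].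
  have zx : x = z by apply/set1P; rewrite -xz porbit_id.
  have /eqP sx : s x == x.
    by rewrite -in_set1 {2}zx -xz -(porbit_apply s x) porbit_id.
  by exists x; rewrite ?inE ?xS ?sx ?eqxx // porbit_fixed.
rewrite inE => /andP[xS /eqP/porbit_fixed sx] ->.
by case: (induced_porbit_type s x) => + _ _; rewrite sx cards1 => ->; rewrite -sx imset_f.
Qed.

Lemma num_cycles_perm_graph S s : perm_on S s ->
  num_cycles (S, perm_edges s) = #|long_orbits s|.
Proof.
move=> onS; rewrite /num_cycles components_perm_graph // card_sep_imset;
  last exact: induced_inj.
apply: eq_card => C; rewrite !inE.
apply/andP/andP => -[/imsetP[x xS ->]]; case: (induced_porbit_type s x) => _ _ ->.
  by move=> gt2; rewrite imset_f.
move=> gt2; rewrite imset_f //; apply: contraLR gt2 => /(out_perm onS)/porbit_fixed ->.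
by rewrite cards1.
Qed.

Lemma num_components_perm_graph S s : perm_on S s ->
  num_components (S, perm_edges s) = #|orbits_in S s|.
Proof.
move=> onS; rewrite /num_components /num_cycles /num_edges /num_vertices.
rewrite components_perm_graph // !(card_sep_imset _ _ (@induced_inj s)).
rewrite -!sum1dep_card !big_mkcondr /= -!big_split /= -sum1_card.
apply: eq_bigr => C /imsetP[x _ ->].
case: (induced_porbit_type s x) => -> -> ->.
by case: #|_| (card_porbit_neq0 s x) => [|[|[]]].
Qed.

(** The points outside S are fixed, and form orbits of their own. *)
Lemma card_porbits_perm_on S s : perm_on S s ->
  #|porbits s| = (#|orbits_in S s| + #|~: S|)%N.
Proof.
move=> onS; have -> : porbits s = orbits_in S s :|: [set [set x] | x in ~: S].
  apply/setP=> C; rewrite inE; apply/imsetP/orP => [[x _ ->]|].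
    case: (boolP (x \in S)) => xS; [left; exact: imset_f | right].
    by rewrite (porbit_fixed (out_perm onS xS)) imset_f // inE.
  case=> /imsetP[x]; first by exists x.
  by rewrite inE => xS ->; exists x => //; rewrite (porbit_fixed (out_perm onS xS)).
rewrite cardsU disjoint_setI0 ?cards0 ?subn0.
  by rewrite (card_imset _ set1_inj).
apply/pred0P=> C /=; apply/negbTE/negP=> /andP[/imsetP[x xS ->]] /imsetP[y].
rewrite inE => yS xy; have := porbit_id s x; rewrite xy inE => /eqP E.
by rewrite -E xS in yS.
Qed.

(** The sign of s is (-1)^(|V| - m), where m counts the orbits of s on the whole
    of V; each point outside S adds one to both |V| and m. *)
Lemma sign_perm_on (R : pzRingType) S s : perm_on S s ->
  (-1) ^+ #|S| * (-1) ^+ s = (-1) ^+ #|orbits_in S s| :> R.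
Proof.
move=> onS; rewrite -[in LHS]signr_odd -signr_addb -[in RHS]signr_odd.
congr (_ ^+ nat_of_bool _).
rewrite /odd_perm (card_porbits_perm_on onS) -(cardsC S) !oddD.
by case: odd; case: odd; case: odd.
Qed.

End PermGraphComponents.

(** * Directing a modified elementary subgraph *)

Section Orientation.
Variable V : finType.
Implicit Types (s t : {perm V}) (S C : {set V}) (x y z : V) (G : sgraph V).
Implicit Types (K H : pregraph V).

Lemma card_edge G f : f \in edges G -> #|f| = 2%N.
Proof.
rewrite inE => /existsP[x /existsP[y /andP[Gxy /eqP->]]].
by rewrite cards2; case: eqP Gxy => // ->; rewrite adj_irr.
Qed.

(** One form for the three kinds of components: a vertex is a cyclic order of
    length one, where the successor of x is x itself and gives no edge, and an edge
    is a cyclic order of length two, whose two steps give the same edge. *)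
Lemma elementary_cyclic_order K :
  [|| is_vertex K, is_edge K | is_cycle K] ->
  (forall f : {set V}, f \in K.2 -> #|f| = 2%N) ->
  exists c : seq V, [/\ uniq c, K.1 = [set x in c]
    & K.2 = [set [set x; next c x] | x in c & next c x != x]].
Proof.
case/or3P=> [/existsP[x /eqP->] _ | /existsP[x /existsP[y /andP[xy /eqP->]]] _ |].
- exists [:: x]; split=> //=; first by apply/setP=> y; rewrite !inE.
  apply/setP=> f; rewrite inE; apply/esym/negbTE/negP => /imsetP[y].
  by rewrite !inE => /andP[/eqP->]; rewrite /= !eqxx.
- have nx : next [:: x; y] x = y by rewrite /= eqxx.
  have ny : next [:: x; y] y = x by rewrite /= eq_sym (negPf xy) eqxx.
  exists [:: x; y]; split; first by rewrite /= inE xy.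
    by apply/setP=> z; rewrite !inE.
  apply/setP=> f; rewrite inE; apply/eqP/imsetP => [->|[z]].
    by exists x; rewrite ?nx // !inE eqxx nx /= eq_sym.
  by rewrite !inE => /andP[/orP[]/eqP-> _ ->]; rewrite ?nx ?ny // setUC.
case/existsP=> c /and4P[_ uc /eqP K1 /eqP K2] card2; exists c; split=> //.
rewrite K2; apply/setP=> f; apply/imsetP/imsetP => -[x xc ->]; exists x => //.
  have : [set x; next c x] \in K.2 by rewrite K2; apply/imsetP; exists x.
  move/card2; rewrite cards2 inE xc /= => n2; rewrite eq_sym; by case: eqP n2.
by move: xc; rewrite inE => /andP[].
Qed.

(** The permutation moves each vertex to its successor in a cyclic order chosen
    on its component; the predecessor gives the inverse, since the successor stays
    in the component. *)
Lemma modified_elementary_perm G H : modified_elementary G H ->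
  exists s, perm_on H.1 s /\ perm_edges s = H.2.
Proof.
case/andP=> /andP[/subsetP subG /forall_inP subH] /forall_inP elem.
pose comp x := [set y in H.1 | connect (pre_adj H) x y].
have /fin_all_exists[ord ordP] : forall C, exists c : seq V,
    C \in comp @: H.1 -> [/\ uniq c, C = [set y in c]
      & [set f in H.2 | f \subset C] =
        [set [set y; next c y] | y in c & next c y != y]].
  move=> C; case: (boolP (C \in comp @: H.1)) => [CP|_]; last by exists [::].
  have KH : (C, [set f in H.2 | f \subset C]) \in components H by apply: imset_f.
  have [|c cP] := elementary_cyclic_order (elem _ KH); last by exists c.
  by move=> f; rewrite inE => /andP[/subG/card_edge].
have compP x : x \in H.1 ->
    [/\ comp x \in comp @: H.1, x \in comp x & comp x =i ord (comp x)].
  move=> xH; have cx : comp x \in comp @: H.1 by apply: imset_f.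
  split=> // [|y]; first by rewrite inE xH connect0.
  by have [_ /setP/(_ y) -> _] := ordP _ cx; rewrite inE.
have comp_eq x y : y \in comp x -> comp y = comp x.
  rewrite inE => /andP[_ xy]; apply/setP=> z; rewrite !inE; congr (_ && _).
  apply/esym; apply: (same_connect _ xy); apply: sym_connect_sym => u v.
  by rewrite /pre_adj /= setUC.
pose succ x := if x \in H.1 then next (ord (comp x)) x else x.
pose pred x := if x \in H.1 then prev (ord (comp x)) x else x.
have succK : cancel succ pred.
  move=> x; rewrite /succ; case: ifPn => xH; last by rewrite /pred (negPf xH).
  have [cx xx ordE] := compP x xH; have [uo _ _] := ordP _ cx.
  have nx : next (ord (comp x)) x \in comp x by rewrite ordE mem_next -ordE.
  rewrite /pred (comp_eq _ _ nx) prev_next //.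
  by move: nx; rewrite inE => /andP[->].
exists (perm (can_inj succK)); split.
  apply/subsetP=> x; rewrite inE permE /succ; case: ifP => // _.
  by rewrite eqxx.
apply/setP=> f; apply/perm_edgesP/idP => [[x]|fH].
  rewrite permE /succ; case: ifPn => [xH nx ->|]; last by rewrite eqxx.
  have [cx xx ordE] := compP x xH; have [_ _ /setP E] := ordP _ cx.
  suff: [set x; next (ord (comp x)) x] \in [set f in H.2 | f \subset comp x].
    by rewrite inE => /andP[].
  by rewrite E; apply/imsetP; exists x; rewrite ?inE -?ordE ?xx.
have := subG f fH; rewrite inE => /existsP[x /existsP[y /andP[_ /eqP fE]]].
have /andP[xH yH] : (x \in H.1) && (y \in H.1).
  by have := subH f fH; rewrite fE subUset !sub1set.
have [cx xx ordE] := compP x xH; have [_ _ /setP/(_ f)] := ordP _ cx.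
have yx : y \in comp x by rewrite inE yH connect1 // /pre_adj /= -fE.
have fx : f \subset comp x by rewrite fE subUset !sub1set xx yx.
rewrite inE fH fx.
move/esym/imsetP=> [z]; rewrite inE => /andP[zo nz] ->.
have zx : z \in comp x by rewrite ordE.
have zH : z \in H.1 by move: zx; rewrite inE => /andP[].
by exists z; rewrite permE /succ zH (comp_eq _ _ zx).
Qed.

End Orientation.

(** * The expansion *)

(** The contribution of a permutation is the weight of its graph without the
    factor 2^c, which counts the permutations with that graph. *)
Lemma perm_term (R : realFieldType) (n : nat) (G : sgraph 'I_n) (alpha : R)
    (S : {set 'I_n}) (s : {perm 'I_n}) (H := (S, perm_edges s)) :
  perm_on S s ->
  (-1) ^+ #|S| * (-1) ^+ s * \prod_(i in S) B_mx alpha G i (s i) =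
  if modified_elementary G H then
    (-1) ^+ num_components H * (1 - alpha) ^+ num_vertices H *
    (2 * alpha - 1) ^+ (#|S| - num_vertices H) *
    \prod_(v in isolated H) (degree G v)%:R
  else 0.
Proof.
move=> onS; rewrite modified_elementary_perm_graph //.
have BE i j : B_mx alpha G i j =
    if j == i then (1 - alpha) * (degree G i)%:R else (2 * alpha - 1) * (G i j)%:R.
  rewrite /B_mx /laplacian !mxE eq_sym; case: eqP => [->|_].
    by rewrite adj_irr mulr1n subr0 mulr0 add0r.
  by rewrite mulr0n sub0r mulrN -mulrBl opprB [_ + (_ - 1)]addrA -mulr2n mulr_natl.
case: ifPn => [/forall_inP Gs | ]; last first.
  rewrite negb_forall => /existsP[x]; rewrite negb_imply => /andP[sx nG].
  have xS : x \in S by apply: contraR sx => /(out_perm onS)->.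
  by rewrite (bigD1 x) //= BE (negPf sx) (negPf nG) mulr0 mul0r mulr0.
rewrite num_components_perm_graph // num_vertices_perm_graph // isolated_perm_graph //.
rewrite sign_perm_on // -!mulrA; congr (_ * _).
set F := [set x in S | s x == x].
rewrite (big_setID F) /= (setIidPr _); last by apply/subsetP=> i; rewrite inE => /andP[].
rewrite (eq_bigr (fun i => (1 - alpha) * (degree G i)%:R)); last first.
  by move=> i; rewrite inE BE => /andP[_ ->].
rewrite big_split prodr_const /= -mulrA; congr (_ * _); rewrite mulrC; congr (_ * _).
rewrite (eq_bigr (fun=> 2 * alpha - 1)); last first.
  by move=> i; rewrite !inE negb_and andbC BE => /andP[iS]; rewrite iS /= => si;
     rewrite (negPf si) Gs // mulr1.
rewrite prodr_const cardsD (setIidPr _) //.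
by apply/subsetP=> i; rewrite inE => /andP[].
Qed.

Theorem corollary5p1 (R : realFieldType) (n : nat) (G : sgraph 'I_n) (alpha : R)
    (halpha : 0 <= alpha <= 1) (k : nat) (hk : (1 <= k <= n)%N) :
  (char_poly (B_mx alpha G))`_(n - k) =
  \sum_(H : pregraph 'I_n | modified_elementary G H && (#|H.1| == k))
    (-1) ^+ num_components H * 2 ^+ num_cycles H *
    (1 - alpha) ^+ num_vertices H * (2 * alpha - 1) ^+ (k - num_vertices H) *
    \prod_(v in isolated H) (degree G v)%:R.
Proof.
case/andP: hk => _ le_kn; rewrite coef_char_poly_perm_on //.
pose w (H : pregraph 'I_n) : R :=
  (-1) ^+ num_components H * 2 ^+ num_cycles H *
    (1 - alpha) ^+ num_vertices H * (2 * alpha - 1) ^+ (k - num_vertices H) *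
    \prod_(v in isolated H) (degree G v)%:R.
transitivity (\sum_(S : {set 'I_n} | #|S| == k)
    \sum_(E | modified_elementary G (S, E)) w (S, E)); last first.
  by rewrite pair_big_dep /=; apply: eq_big => [[S E]|[S E] _]; rewrite // andbC.
apply: eq_bigr => S /eqP Sk; rewrite (partition_big (@perm_edges _) predT) //=.
rewrite [RHS]big_mkcond; apply: eq_bigr => E _ /=.
rewrite -Sk; under eq_bigr => s sP.
  case/andP: sP => onS /eqP sE; rewrite perm_term // sE.
  over.
case: ifPn => [ME|_]; last by rewrite big1.
have [s [onS /= sE]] := modified_elementary_perm ME.
rewrite sumr_const.
have -> : #|[pred t | perm_on S t && (perm_edges t == E)]| = (2 ^ num_cycles (S, E))%N.
  rewrite -sE num_cycles_perm_graph // -card_same_edges; apply: eq_card => t.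
  rewrite !inE; apply: andb_idl => /eqP sE'.
  exact: perm_on_same_edges onS.
rewrite /w -[LHS]mulr_natr natrX Sk -!mulrA; congr (_ * _).
by rewrite !mulrA mulrC !mulrA.
Qed.
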